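(* $\mathrm{NID}\notin\Sigma_2$.
   Context: Fix a universal prefix-free machine $U$. $K$ denotes prefix-free Kolmogorov complexity and $K(x\mid y)$ conditional prefix-free complexity. For binary strings $x,y$ let $E(x,y)=\max\{K(x\mid y),K(y\mid x)\}$ and $\mathrm{NID}(x,y)=\dfrac{E(x,y)}{\max\{K(x),K(y)\}}$, a rational-valued function on pairs of strings. The oscillation classes for a function $F$ (here with domain pairs of binary strings and values in $\mathbb{Q}$) are defined inductively, where an approximation of $F$ is a computable $f$ with $\lim_{s\to\infty}f(z,s)=F(z)$ for all $z$: $F\in\Sigma_1$ if it has an approximation nondecreasing in $s$; $F\in\Pi_1$ if it has one nonincreasing in $s$; $F\in\Sigma_{n+1}$ if it has a computable approximation $f$ such that for every $z$ there is $s_z$ with $f(z,t)$ nondecreasing for $t<s_z$ and $(f(z,t))_{t\geq s_z}$ behaving as a $\Pi_n$-approximation; $F\in\Pi_{n+1}$ likewise with nonincreasing for $t<s_z$ and $(f(z,t))_{t\geq s_z}$ a $\Sigma_n$-approximation. Thus $\Sigma_n$ (resp. $\Pi_n$) consists of the functions having a computable approximation that changes direction at most $n-1$ times on each input (at most $n$ monotone phases), starting by going up (resp. down). *)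

(* Defs.v *)
From Stdlib Require Import Arith List ZArith QArith Qabs ClassicalEpsilon.
Import ListNotations.
Local Open Scope nat_scope.

Inductive prog : Type :=
| PZero : prog
| PSucc : prog
| PProj : nat -> prog
| PComp : prog -> list prog -> prog
| PRec  : prog -> prog -> prog
| PMin  : prog -> prog.

Inductive eval : prog -> list nat -> nat -> Prop :=
| ev_zero xs : eval PZero xs 0
| ev_succ x : eval PSucc [x] (S x)
| ev_proj i xs : i < length xs -> eval (PProj i) xs (nth i xs 0)
| ev_comp f gs xs ys y :
    Forall2 (fun g v => eval g xs v) gs ys -> eval f ys y -> eval (PComp f gs) xs y
| ev_rec0 f g xs y : eval f xs y -> eval (PRec f g) (0 :: xs) y
| ev_recS f g n xs r y :
    eval (PRec f g) (n :: xs) r -> eval g (n :: r :: xs) y ->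
    eval (PRec f g) (S n :: xs) y
| ev_min f xs n :
    eval f (n :: xs) 0 ->
    (forall m, m < n -> exists v, v <> 0 /\ eval f (m :: xs) v) ->
    eval (PMin f) xs n.

Definition bits := list bool.

Fixpoint enc_bits (s : bits) : nat :=
  match s with
  | [] => 0
  | false :: t => 2 * enc_bits t + 1
  | true :: t => 2 * enc_bits t + 2
  end.

Definition cpair (a b : nat) : nat := (a + b) * (a + b + 1) / 2 + b.

Definition enc_Z (z : Z) : nat :=
  match z with
  | Z0 => 0
  | Zpos p => 2 * Pos.to_nat p - 1
  | Zneg p => 2 * Pos.to_nat p
  end.

Definition enc_Q (q : Q) : nat := cpair (enc_Z (Qnum q)) (Pos.to_nat (Qden q) - 1).

Definition enc_pair (z : bits * bits) : nat := cpair (enc_bits (fst z)) (enc_bits (snd z)).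

(* A machine maps (program p, condition y) to an optional output. *)
Definition machine := bits -> bits -> option bits.

Definition partial_computable_machine (M : machine) : Prop :=
  exists e : prog, forall p y v,
    eval e [cpair (enc_bits p) (enc_bits y)] v <->
    exists x, M p y = Some x /\ v = enc_bits x.

Definition proper_prefix (p q : bits) : Prop := exists r, r <> [] /\ q = p ++ r.

Definition prefix_free_machine (M : machine) : Prop :=
  forall y p q, M p y <> None -> M q y <> None -> ~ proper_prefix p q.

Definition prefix_free_pc_machine (M : machine) : Prop :=
  partial_computable_machine M /\ prefix_free_machine M.

Definition universal_pf_machine (U : machine) : Prop :=
  prefix_free_pc_machine U /\
  forall M, prefix_free_pc_machine M ->
    exists rho : bits, forall p y, U (rho ++ p) y = M p y.

Definition IsKc (U : machine) (x y : bits) (k : nat) : Prop :=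
  (exists p, U p y = Some x /\ length p = k) /\
  (forall p, U p y = Some x -> k <= length p).

Definition Kc (U : machine) (x y : bits) : nat :=
  epsilon (inhabits 0) (fun k => IsKc U x y k).

Definition K (U : machine) (x : bits) : nat := Kc U x [].

Definition E (U : machine) (x y : bits) : nat := Nat.max (Kc U x y) (Kc U y x).

Definition natQ (n : nat) : Q := inject_Z (Z.of_nat n).

Definition NID (U : machine) (z : bits * bits) : Q :=
  (natQ (E U (fst z) (snd z)) / natQ (Nat.max (K U (fst z)) (K U (snd z))))%Q.

Local Open Scope Q_scope.
Definition computable_approx (f : bits * bits -> nat -> Q) : Prop :=
  exists e : prog, forall z s, eval e [enc_pair z; s] (enc_Q (f z s)).

Definition approximates (f : bits * bits -> nat -> Q) (F : bits * bits -> Q) : Prop :=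
  forall z (eps : Q), 0 < eps -> exists s0, forall s, (s0 <= s)%nat -> Qabs (f z s - F z) < eps.

(* [phases up n g]: g has at most n monotone phases, the first one
   nondecreasing if up = true, nonincreasing if up = false. *)
Fixpoint phases (up : bool) (n : nat) (g : nat -> Q) {struct n} : Prop :=
  match n with
  | O => False
  | S O => forall t1 t2, (t1 <= t2)%nat -> if up then g t1 <= g t2 else g t2 <= g t1
  | S m => exists s, (forall t1 t2, (t1 <= t2 < s)%nat -> if up then g t1 <= g t2 else g t2 <= g t1)
                     /\ phases (negb up) m (fun t => g (s + t)%nat)
  end.

Definition Sigma_n (n : nat) (F : bits * bits -> Q) : Prop :=
  exists f, computable_approx f /\ approximates f F /\ forall z, phases true n (f z).

Definition Pi_n (n : nat) (F : bits * bits -> Q) : Prop :=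
  exists f, computable_approx f /\ approximates f F /\ forall z, phases false n (f z).

(* Main.v *)
Require Import Defs.
From Stdlib Require Import Arith List ZArith QArith Qabs ClassicalEpsilon FinFun Lia Lqa.
Import ListNotations.
Local Open Scope nat_scope.

(** Suppose [f] goes up and then down towards NID, and write [y = <x, <j, i>>].  For given
    [m] and [x], most [j] make [K(y | x)] large for all [i < 2^m], so a search finds [j] and
    a stage [s1] with [f(x, y, s1) >= 1/16] for all these [i].  As [j] is computable from
    [m] and [x], we have [K(y | x) <= 2m + O(1)] and [K(x | y) = O(1)]; hence, for complex
    [x], NID is tiny and a search over [x] finds one for which [f(x, y, s2) <= 1/32] at some
    [s2 >= s1].  From then on [f] cannot grow, so NID is at most [1/32] on these pairs.
    But this [x] is computable from [m], so [K(x)] and [K(y)] are at most [2m + O(1)], while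
    [K(y | x) >= m] for at least one of the [2^m] values of [i]: a contradiction. *)

(** * Bit strings and their codes *)

(** [enc_bits] is bijective base-2 numeration, lowest digit first, with [false] as 1 and [true] as
    2; this is its successor with carry. *)
Fixpoint bits_succ (w : bits) : bits :=
  match w with
  | [] => [false]
  | false :: t => true :: t
  | true :: t => false :: bits_succ t
  end.

Fixpoint dec_bits (n : nat) : bits :=
  match n with
  | 0 => []
  | S k => bits_succ (dec_bits k)
  end.

Lemma enc_bits_succ w : enc_bits (bits_succ w) = S (enc_bits w).
Proof. induction w as [|[] w IH]; simpl; lia. Qed.

Lemma enc_dec_bits n : enc_bits (dec_bits n) = n.
Proof. induction n as [|n IH]; simpl; [reflexivity|]. now rewrite enc_bits_succ, IH. Qed.

Lemma enc_bits_inj u v : enc_bits u = enc_bits v -> u = v.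
Proof.
  revert v; induction u as [|[] u IH]; intros [|[] v]; simpl; intros H;
    try reflexivity; try lia; f_equal; apply IH; lia.
Qed.

Lemma dec_enc_bits w : dec_bits (enc_bits w) = w.
Proof. apply enc_bits_inj, enc_dec_bits. Qed.

Lemma dec_bits_inj a b : dec_bits a = dec_bits b -> a = b.
Proof. intros H. rewrite <- (enc_dec_bits a), H. apply enc_dec_bits. Qed.

(** The binary digits of [S (enc_bits w)], lowest first, are the bits of [w] followed by a leading
    1. *)
Lemma enc_bits_bounds w : 2 ^ length w <= S (enc_bits w) < 2 ^ S (length w).
Proof. induction w as [|[] w IH]; simpl in *; lia. Qed.

Lemma length_of_enc_bounds w m :
  2 ^ m <= S (enc_bits w) -> S (enc_bits w) < 2 ^ S m -> length w = m.
Proof.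
  intros H1 H2. pose proof (enc_bits_bounds w) as [H3 H4].
  assert (H5 : 2 ^ m < 2 ^ S (length w)) by lia.
  assert (H6 : 2 ^ length w < 2 ^ S m) by lia.
  apply Nat.pow_lt_mono_r_iff in H5; [|lia].
  apply Nat.pow_lt_mono_r_iff in H6; lia.
Qed.

Lemma length_dec_bits_le a n : a < 2 ^ n -> length (dec_bits a) <= n.
Proof.
  intros H. pose proof (enc_bits_bounds (dec_bits a)) as [H1 _].
  rewrite enc_dec_bits in H1.
  apply (Nat.pow_le_mono_r_iff 2); lia.
Qed.

(** * Pairing *)

Fixpoint tri (n : nat) : nat := match n with 0 => 0 | S k => S k + tri k end.

Lemma cpair_tri a b : cpair a b = tri (a + b) + b.
Proof.
  unfold cpair. f_equal. generalize (a + b) as n; intros n.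
  assert (H : n * (n + 1) = tri n * 2) by (induction n; simpl in *; lia).
  rewrite H. apply Nat.div_mul. lia.
Qed.

Lemma tri_mono a b : a <= b -> tri a <= tri b.
Proof. induction 1; simpl; lia. Qed.

(* The largest [d] with [tri d <= v]. *)
Fixpoint diag (v : nat) : nat :=
  match v with
  | 0 => 0
  | S k => diag k + (1 - (tri (S (diag k)) - S k))
  end.

Lemma diag_spec v : tri (diag v) <= v < tri (S (diag v)).
Proof.
  induction v as [|v IH]; [simpl; lia|].
  (* The truncated difference vanishes exactly when [S v] opens the next diagonal. *)
  cbn [diag]. destruct (tri (S (diag v)) - S v) eqn:Hd.
  - replace (diag v + (1 - 0)) with (S (diag v)) by lia.
    cbn [tri] in *. lia.
  - replace (diag v + (1 - S n)) with (diag v) by lia. lia.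
Qed.

Definition csnd (v : nat) : nat := v - tri (diag v).
Definition cfst (v : nat) : nat := diag v - csnd v.

Lemma diag_cpair a b : diag (cpair a b) = a + b.
Proof.
  rewrite cpair_tri. pose proof (diag_spec (tri (a + b) + b)) as [H1 H2].
  set (d := diag _) in *.
  destruct (lt_eq_lt_dec d (a + b)) as [[H|H]|H]; [|exact H|].
  - pose proof (tri_mono (S d) (a + b) H). lia.
  - pose proof (tri_mono (S (a + b)) d H) as H3. cbn [tri] in H3. lia.
Qed.

Lemma csnd_cpair a b : csnd (cpair a b) = b.
Proof. unfold csnd. rewrite diag_cpair, cpair_tri. lia. Qed.

Lemma cfst_cpair a b : cfst (cpair a b) = a.
Proof. unfold cfst. rewrite csnd_cpair, diag_cpair. lia. Qed.

Lemma cpair_inj a b a' b' : cpair a b = cpair a' b' -> a = a' /\ b = b'.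
Proof.
  intros H. split.
  - rewrite <- (cfst_cpair a b), H. apply cfst_cpair.
  - rewrite <- (csnd_cpair a b), H. apply csnd_cpair.
Qed.

(** [tri k] is half of [k * (k + 1)], here with [k = a + b < 2 * 2 ^ n]. So the length of a coded
    pair is linear in [n], as the complexity estimates require. *)
Lemma cpair_lt a b n : a < 2 ^ n -> b < 2 ^ n -> cpair a b < 2 ^ (2 * n + 2).
Proof.
  intros Ha Hb. rewrite cpair_tri.
  assert (H : forall k, 2 * tri k = k * (k + 1)) by (induction k; simpl in *; lia).
  specialize (H (a + b)).
  replace (2 ^ (2 * n + 2)) with (4 * (2 ^ n * 2 ^ n))
    by (rewrite Nat.pow_add_r, Nat.mul_comm, Nat.pow_mul_r; simpl (2 ^ 2);
        rewrite <- Nat.pow_mul_l; simpl; lia).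
  nia.
Qed.

(** * Determinism of evaluation and basic programs *)

(** The generated principle gives no induction hypothesis for the programs in the list of a
    [PComp]. *)
Lemma prog_nested_ind (P : prog -> Prop) :
  P PZero -> P PSucc -> (forall i, P (PProj i)) ->
  (forall f gs, P f -> Forall P gs -> P (PComp f gs)) ->
  (forall f g, P f -> P g -> P (PRec f g)) ->
  (forall f, P f -> P (PMin f)) ->
  forall e, P e.
Proof.
  intros Hz Hs Hp Hc Hr Hm.
  fix IH 1. intros [| |i|f gs|f g|f].
  - exact Hz.
  - exact Hs.
  - apply Hp.
  - apply Hc; [apply IH|].
    induction gs as [|g gs IHgs]; constructor; [apply IH|exact IHgs].
  - apply Hr; apply IH.
  - apply Hm, IH.
Qed.

Lemma eval_det e xs v w : eval e xs v -> eval e xs w -> v = w.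
Proof.
  revert e xs v w.
  refine (prog_nested_ind _ _ _ _ _ _ _).
  - intros xs v w H1 H2. now inversion H1; inversion H2.
  - intros xs v w H1 H2. inversion H1; subst. now inversion H2.
  - intros i xs v w H1 H2. now inversion H1; inversion H2.
  - intros f gs IHf IHgs xs v w H1 H2.
    inversion H1 as [| | |? ? ? ys ? Hgs Hf| | |]; subst.
    inversion H2 as [| | |? ? ? ys' ? Hgs' Hf'| | |]; subst.
    assert (ys = ys') as <-; [|eapply IHf; eassumption].
    clear H1 H2 Hf Hf' IHf. revert ys ys' Hgs Hgs'.
    induction IHgs as [|g gs Hg _ IH]; intros ys ys' Hgs Hgs';
      inversion Hgs; subst; inversion Hgs'; subst; [reflexivity|].
    f_equal; [eapply Hg; eassumption|apply IH; assumption].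
  - intros f g IHf IHg xs v w H1 H2.
    destruct xs as [|n xs]; [inversion H1|].
    revert v w H1 H2; induction n as [|n IHn]; intros v w H1 H2;
      inversion H1; subst; inversion H2; subst.
    + eapply IHf; eassumption.
    + match goal with
      | Ha : eval (PRec f g) (n :: xs) ?a, Hb : eval (PRec f g) (n :: xs) ?b |- _ =>
          pose proof (IHn _ _ Ha Hb); subst
      end.
      eapply IHg; eassumption.
  - intros f IHf xs v w H1 H2.
    inversion H1 as [| | | | | |? ? ? Hv Hlv]; subst.
    inversion H2 as [| | | | | |? ? ? Hw Hlw]; subst.
    destruct (lt_eq_lt_dec v w) as [[H|H]|H]; [|exact H|].
    + destruct (Hlw v H) as (u & Hu & Hu'). elim Hu. eapply IHf; eassumption.
    + destruct (Hlv w H) as (u & Hu & Hu'). elim Hu. eapply IHf; eassumption.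
Qed.

Lemma eval_comp1 f g xs a y :
  eval g xs a -> eval f [a] y -> eval (PComp f [g]) xs y.
Proof. intros. eapply ev_comp; [|eassumption]. auto. Qed.

Lemma eval_comp2 f g1 g2 xs a b y :
  eval g1 xs a -> eval g2 xs b -> eval f [a; b] y -> eval (PComp f [g1; g2]) xs y.
Proof. intros. eapply ev_comp; [|eassumption]. auto. Qed.

Lemma eval_comp3 f g1 g2 g3 xs a b c y :
  eval g1 xs a -> eval g2 xs b -> eval g3 xs c -> eval f [a; b; c] y ->
  eval (PComp f [g1; g2; g3]) xs y.
Proof. intros. eapply ev_comp; [|eassumption]. auto. Qed.

Lemma eval_comp4 f g1 g2 g3 g4 xs a b c d y :
  eval g1 xs a -> eval g2 xs b -> eval g3 xs c -> eval g4 xs d ->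
  eval f [a; b; c; d] y -> eval (PComp f [g1; g2; g3; g4]) xs y.
Proof. intros. eapply ev_comp; [|eassumption]. auto. Qed.

Lemma eval_value e xs v w : eval e xs v -> v = w -> eval e xs w.
Proof. now intros H <-. Qed.

Create HintDb ev discriminated.
#[local] Hint Resolve ev_zero ev_succ : ev.

Ltac ev_step :=
  first [ solve [eauto 1 with ev]
        | apply ev_proj; simpl; lia
        | eapply eval_comp1 | eapply eval_comp2 | eapply eval_comp3 | eapply eval_comp4 ].
Ltac ev := repeat ev_step.
(** Evaluation determines the value first; its equality with the claimed value is a separate
    goal. *)
Ltac ev_as := eapply eval_value; [ev|try reflexivity].

Definition padd := PRec (PProj 0) (PComp PSucc [PProj 1]).
Lemma eval_padd a b : eval padd [a; b] (a + b).
Proof.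
  induction a as [|a IH]; [apply ev_rec0; ev_as|].
  eapply ev_recS; [exact IH|ev_as].
Qed.
#[local] Hint Resolve eval_padd : ev.

Definition ppred := PRec PZero (PProj 0).
Lemma eval_ppred a : eval ppred [a] (pred a).
Proof.
  induction a as [|a IH]; [apply ev_rec0; ev_as|].
  eapply ev_recS; [exact IH|ev_as].
Qed.
#[local] Hint Resolve eval_ppred : ev.

Definition psub_rev := PRec (PProj 0) (PComp ppred [PProj 1]).
Lemma eval_psub_rev a b : eval psub_rev [b; a] (a - b).
Proof.
  induction b as [|b IH]; [apply ev_rec0; ev_as; simpl; lia|].
  eapply ev_recS; [exact IH|ev_as]. simpl; lia.
Qed.
#[local] Hint Resolve eval_psub_rev : ev.

Definition psub := PComp psub_rev [PProj 1; PProj 0].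
Lemma eval_psub a b : eval psub [a; b] (a - b).
Proof. unfold psub. ev_as. Qed.
#[local] Hint Resolve eval_psub : ev.

Definition pmul := PRec PZero (PComp padd [PProj 2; PProj 1]).
Lemma eval_pmul a b : eval pmul [a; b] (a * b).
Proof.
  induction a as [|a IH]; [apply ev_rec0; ev_as|].
  eapply ev_recS; [exact IH|ev_as].
Qed.
#[local] Hint Resolve eval_pmul : ev.

Fixpoint pconst (n : nat) : prog :=
  match n with 0 => PZero | S k => PComp PSucc [pconst k] end.
Lemma eval_pconst n xs : eval (pconst n) xs n.
Proof. induction n as [|n IH]; simpl; [ev|]. eapply eval_comp1; [exact IH|ev]. Qed.
#[local] Hint Resolve eval_pconst : ev.

Definition ppow2 := PRec (pconst 1) (PComp padd [PProj 1; PProj 1]).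
Lemma eval_ppow2 n : eval ppow2 [n] (2 ^ n).
Proof.
  induction n as [|n IH]; [apply ev_rec0; ev|].
  eapply ev_recS; [exact IH|ev_as]. simpl; lia.
Qed.
#[local] Hint Resolve eval_ppow2 : ev.

Definition ptri := PRec PZero (PComp padd [PComp PSucc [PProj 0]; PProj 1]).
Lemma eval_ptri n : eval ptri [n] (tri n).
Proof.
  induction n as [|n IH]; [apply ev_rec0; ev|].
  eapply ev_recS; [exact IH|ev_as].
Qed.
#[local] Hint Resolve eval_ptri : ev.

Definition pcpair := PComp padd [PComp ptri [PComp padd [PProj 0; PProj 1]]; PProj 1].
Lemma eval_pcpair a b : eval pcpair [a; b] (cpair a b).
Proof. unfold pcpair. ev_as. now rewrite cpair_tri. Qed.
#[local] Hint Resolve eval_pcpair : ev.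

Definition pdiag := PRec PZero
  (PComp padd [PProj 1; PComp psub [pconst 1;
     PComp psub [PComp ptri [PComp PSucc [PProj 1]]; PComp PSucc [PProj 0]]]]).
Lemma eval_pdiag v : eval pdiag [v] (diag v).
Proof.
  induction v as [|v IH]; [apply ev_rec0; ev|].
  eapply ev_recS; [exact IH|ev_as].
Qed.
#[local] Hint Resolve eval_pdiag : ev.

Definition pcsnd := PComp psub [PProj 0; PComp ptri [pdiag]].
Lemma eval_pcsnd v : eval pcsnd [v] (csnd v).
Proof. unfold pcsnd. ev_as. Qed.
#[local] Hint Resolve eval_pcsnd : ev.

Definition pcfst := PComp psub [pdiag; pcsnd].
Lemma eval_pcfst v : eval pcfst [v] (cfst v).
Proof. unfold pcfst. ev_as. Qed.
#[local] Hint Resolve eval_pcfst : ev.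

Fixpoint parity (n : nat) : nat := match n with 0 => 0 | S k => 1 - parity k end.
Definition pparity := PRec PZero (PComp psub [pconst 1; PProj 1]).
Lemma eval_pparity n : eval pparity [n] (parity n).
Proof.
  induction n as [|n IH]; [apply ev_rec0; ev|].
  eapply ev_recS; [exact IH|ev_as].
Qed.
#[local] Hint Resolve eval_pparity : ev.

Lemma parity_double n : parity (2 * n) = 0 /\ parity (S (2 * n)) = 1.
Proof.
  induction n as [|n [IH1 IH2]]; [split; reflexivity|].
  replace (2 * S n) with (S (S (2 * n))) by lia.
  cbn [parity] in *. rewrite IH1. split; reflexivity.
Qed.

(** A sum of naturals vanishes iff all its terms do, which turns a bounded universal quantifier into
    a test that [PMin] can search on. *)
Fixpoint sum_below (T : nat -> nat) (n : nat) : nat :=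
  match n with 0 => 0 | S k => sum_below T k + T k end.

Lemma sum_below_zero T n : sum_below T n = 0 <-> forall a, a < n -> T a = 0.
Proof.
  induction n as [|n IH]; simpl; [split; intros; lia|].
  split.
  - intros H a Ha. destruct (Nat.eq_dec a n) as [->|]; [lia|].
    apply IH; lia.
  - intros H. rewrite (H n) by lia. rewrite (proj2 IH); [reflexivity|].
    intros a Ha. apply H. lia.
Qed.

(** [PRec] inserts the partial sum after the counter, so the projections passed to [t] skip index
    1. *)
Definition psum (t : prog) := PRec PZero
  (PComp padd [PProj 1; PComp t [PProj 0; PProj 2; PProj 3; PProj 4]]).
Lemma eval_psum t T x y z n :
  (forall a, eval t [a; x; y; z] (T a)) ->
  eval (psum t) [n; x; y; z] (sum_below T n).
Proof.
  intros H. induction n as [|n IH]; [apply ev_rec0; ev|].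
  eapply ev_recS; [exact IH|]. eapply eval_comp2; [ev|eapply eval_comp4; [ev..|apply H]|ev_as].
Qed.

(** Totality of [t] supplies the nonzero values that [ev_min] demands below the least zero. *)
Lemma eval_pmin t T xs :
  (forall n, eval t (n :: xs) (T n)) -> (exists n, T n = 0) ->
  exists n, T n = 0 /\ eval (PMin t) xs n.
Proof.
  intros Ht [n0 Hn0].
  destruct (dec_inh_nat_subset_has_unique_least_element (fun n => T n = 0))
    as (n & [Hn Hmin] & _).
  - intros n. lia.
  - eauto.
  - exists n. split; [exact Hn|]. apply ev_min.
    + rewrite <- Hn. apply Ht.
    + intros m Hm. exists (T m). split; [|apply Ht].
      intros H. apply Hmin in H. lia.
Qed.

(** * Complexity bounds *)

Fixpoint parse_code (p : bits) : option (nat * bits) :=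
  match p with
  | [] => None
  | false :: w => Some (0, w)
  | true :: t =>
      match parse_code t with
      | Some (m, w) => Some (S m, w)
      | None => None
      end
  end.

Lemma parse_code_repeat m w : parse_code (repeat true m ++ false :: w) = Some (m, w).
Proof. induction m as [|m IH]; simpl; [|rewrite IH]; reflexivity. Qed.

Lemma parse_code_inv p m w :
  parse_code p = Some (m, w) -> p = repeat true m ++ false :: w.
Proof.
  revert m w; induction p as [|[] p IH]; simpl; intros m w H; [discriminate| |].
  - destruct (parse_code p) as [[m' w']|]; [|discriminate].
    injection H as <- <-. simpl. f_equal. now apply IH.
  - injection H as <- <-. reflexivity.
Qed.

(* The domain consists of the prefix-free codes [1^m 0 w] with [length w = m]. *)
Definition code_machine (H : nat -> nat -> nat -> nat) : machine := fun p y =>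
  match parse_code p with
  | Some (m, w) =>
      if length w =? m then Some (dec_bits (H m (enc_bits w) (enc_bits y))) else None
  | None => None
  end.

Lemma code_machine_inv H p y x :
  code_machine H p y = Some x ->
  exists w, p = repeat true (length w) ++ false :: w /\
            x = dec_bits (H (length w) (enc_bits w) (enc_bits y)).
Proof.
  unfold code_machine. destruct (parse_code p) as [[m w]|] eqn:Hp; [|discriminate].
  destruct (Nat.eqb_spec (length w) m) as [<-|]; [|discriminate].
  intros [= <-]. exists w. split; [now apply parse_code_inv|reflexivity].
Qed.

Lemma code_machine_code H w y :
  code_machine H (repeat true (length w) ++ false :: w) y =
  Some (dec_bits (H (length w) (enc_bits w) (enc_bits y))).
Proof. unfold code_machine. now rewrite parse_code_repeat, Nat.eqb_refl. Qed.

(** The code of the string [1^m 0 w] when [a] is the code of [w]. The first bit is outermost in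
    [enc_bits], so each leading 1 is one step of the recursion. *)
Fixpoint enc_code (m a : nat) : nat :=
  match m with 0 => 2 * a + 1 | S k => 2 * enc_code k a + 2 end.

Lemma enc_code_spec m w : enc_code m (enc_bits w) = enc_bits (repeat true m ++ false :: w).
Proof. induction m as [|m IH]; simpl in *; lia. Qed.

Definition penc_code := PRec (PComp padd [PComp padd [PProj 0; PProj 0]; pconst 1])
  (PComp padd [PComp padd [PProj 1; PProj 1]; pconst 2]).
Lemma eval_penc_code m a : eval penc_code [m; a] (enc_code m a).
Proof.
  induction m as [|m IH]; [apply ev_rec0; ev_as; simpl; lia|].
  eapply ev_recS; [exact IH|ev_as]. simpl; lia.
Qed.
#[local] Hint Resolve eval_penc_code : ev.

(* Vanishes iff [u] codes a pair [(m, enc_bits w)] with [length w = m] and [v] codes a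
   pair whose first component is the code [1^m 0 w]. *)
Definition code_test (u v : nat) : nat :=
  ((enc_code (cfst u) (csnd u) - cfst v) + (cfst v - enc_code (cfst u) (csnd u)))
  + ((2 ^ cfst u - S (csnd u)) + (S (S (csnd u)) - 2 ^ S (cfst u))).

Definition pcode_test :=
  let m := PComp pcfst [PProj 0] in
  let a := PComp pcsnd [PProj 0] in
  let p := PComp pcfst [PProj 1] in
  let c := PComp penc_code [m; a] in
  PComp padd
    [PComp padd [PComp psub [c; p]; PComp psub [p; c]];
     PComp padd [PComp psub [PComp ppow2 [m]; PComp PSucc [a]];
                 PComp psub [PComp PSucc [PComp PSucc [a]]; PComp ppow2 [PComp PSucc [m]]]]].

Lemma eval_pcode_test u v : eval pcode_test [u; v] (code_test u v).
Proof. unfold pcode_test. cbv zeta. ev_as. Qed.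
#[local] Hint Resolve eval_pcode_test : ev.

Lemma code_test_zero u p y :
  code_test u (cpair (enc_bits p) y) = 0 <->
  exists w, p = repeat true (length w) ++ false :: w /\
            cfst u = length w /\ csnd u = enc_bits w.
Proof.
  unfold code_test. rewrite cfst_cpair. split.
  - intros H. exists (dec_bits (csnd u)).
    rewrite <- (enc_dec_bits (csnd u)) in H.
    set (w := dec_bits (csnd u)) in *.
    assert (Hl : length w = cfst u) by (apply length_of_enc_bounds; lia).
    rewrite enc_code_spec in H. rewrite Hl. repeat split.
    + apply enc_bits_inj. lia.
    + unfold w. now rewrite enc_dec_bits.
  - intros (w & -> & -> & ->). rewrite enc_code_spec.
    pose proof (enc_bits_bounds w). lia.
Qed.

(** A search for the pair of [m] and the code of [w] that describes [p] halts exactly when [p] is a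
    code, and then [h] is applied. No code properly extends another, since the leading ones fix the
    length. *)
Lemma code_machine_pf H h :
  (forall m a b, eval h [m; a; b] (H m a b)) ->
  prefix_free_pc_machine (code_machine H).
Proof.
  intros Hh. split.
  - exists (PComp h [PComp pcfst [PMin pcode_test]; PComp pcsnd [PMin pcode_test]; pcsnd]).
    intros p y v.
    assert (Hu : forall u, eval (PMin pcode_test) [cpair (enc_bits p) (enc_bits y)] u ->
      exists w, p = repeat true (length w) ++ false :: w /\
                cfst u = length w /\ csnd u = enc_bits w).
    { intros u Hu. apply (code_test_zero u p (enc_bits y)).
      inversion Hu as [| | | | | |? ? ? H0 _]; subst.
      eapply eval_det; [apply eval_pcode_test|exact H0]. }
    assert (Hout : forall w u, p = repeat true (length w) ++ false :: w ->
      eval (PMin pcode_test) [cpair (enc_bits p) (enc_bits y)] u ->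
      eval (PComp h [PComp pcfst [PMin pcode_test]; PComp pcsnd [PMin pcode_test]; pcsnd])
        [cpair (enc_bits p) (enc_bits y)] (H (length w) (enc_bits w) (enc_bits y))).
    { intros w u Hp Hmin. destruct (Hu u Hmin) as (w' & Hp' & Hm & Ha).
      assert (Some (length w, w) = Some (length w', w')) as [= _ ->]
        by (rewrite <- !parse_code_repeat; congruence).
      rewrite <- Hm, <- Ha. eapply eval_comp3.
      - eapply eval_comp1; [exact Hmin|]. ev.
      - eapply eval_comp1; [exact Hmin|]. ev.
      - eapply eval_value; [ev|apply csnd_cpair].
      - apply Hh. }
    split.
    + intros Hv.
      (* A composition has a value only if its arguments do, so the search must have halted. *)
      assert (exists u, eval (PMin pcode_test) [cpair (enc_bits p) (enc_bits y)] u)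
        as [u Hmin].
      { inversion Hv as [| | |? ? ? ys ? Hgs _| | |]; subst.
        inversion Hgs as [|? ? ? ? Hg _]; subst.
        inversion Hg as [| | |? ? ? us ? Hgs' _| | |]; subst.
        inversion Hgs'; subst. eauto. }
      destruct (Hu u Hmin) as (w & Hp & _).
      exists (dec_bits (H (length w) (enc_bits w) (enc_bits y))). split.
      * rewrite Hp. apply code_machine_code.
      * rewrite enc_dec_bits. eapply eval_det; [exact Hv|]. eapply Hout; eassumption.
    + intros (x & Hx & ->). apply code_machine_inv in Hx as (w & Hp & ->).
      rewrite enc_dec_bits.
      destruct (eval_pmin pcode_test
        (fun u => code_test u (cpair (enc_bits p) (enc_bits y)))
        [cpair (enc_bits p) (enc_bits y)]) as (u & _ & Hmin).
      * intros u. apply eval_pcode_test.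
      * exists (cpair (length w) (enc_bits w)). apply code_test_zero.
        exists w. rewrite cfst_cpair, csnd_cpair. auto.
      * eapply Hout; eassumption.
  - intros y p q Hp Hq (r & Hr & Heq).
    destruct (code_machine H p y) as [x|] eqn:Ep; [|congruence].
    destruct (code_machine H q y) as [x'|] eqn:Eq; [|congruence].
    apply code_machine_inv in Ep as (w & Hpw & _), Eq as (w' & Hqw & _).
    assert (E2 : parse_code q = Some (length w, w ++ r)).
    { rewrite Heq, Hpw, <- app_assoc. apply parse_code_repeat. }
    rewrite Hqw, parse_code_repeat in E2. injection E2 as E2 E3.
    rewrite E3, length_app in E2.
    destruct r; [congruence|]. simpl in E2. lia.
Qed.

(** [U] simulates the code machine behind a fixed prefix [rho], and the code of [w] has length
    [2 * length w + 1]. That [p] is nonempty serves the positivity of [Kc]. *)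
Lemma short_programs U (HU : universal_pf_machine U) H h :
  (forall m a b, eval h [m; a; b] (H m a b)) ->
  exists c, forall w y,
    exists p, p <> [] /\ length p <= 2 * length w + c /\
      U p y = Some (dec_bits (H (length w) (enc_bits w) (enc_bits y))).
Proof.
  intros Hh. destruct (proj2 HU _ (code_machine_pf H h Hh)) as [rho Hrho].
  exists (length rho + 1). intros w y.
  exists (rho ++ repeat true (length w) ++ false :: w). repeat split.
  - destruct rho; [|discriminate]. destruct (length w); discriminate.
  - rewrite !length_app, repeat_length. simpl. lia.
  - now rewrite Hrho, code_machine_code.
Qed.

(** The code machine that outputs [w] itself yields some program for [x], hence a shortest one, so
    [epsilon] has a witness to choose. *)
Lemma Kc_spec U (HU : universal_pf_machine U) x y : IsKc U x y (Kc U x y).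
Proof.
  unfold Kc. apply epsilon_spec.
  destruct (short_programs U HU (fun _ a _ => a) (PProj 1)) as [c Hc];
    [intros; ev_as|].
  destruct (Hc x y) as (p & _ & _ & Hp). rewrite dec_enc_bits in Hp.
  destruct (dec_inh_nat_subset_has_unique_least_element
    (fun k => exists p, U p y = Some x /\ length p = k)) as (k & [Hk Hmin] & _).
  - intros k. apply classic.
  - eauto.
  - exists k. split; [exact Hk|]. intros q Hq. apply Hmin. eauto.
Qed.

(** If the empty program halted on [y], it would be a proper prefix of a nonempty program that also
    halts on [y]. *)
Lemma Kc_pos U (HU : universal_pf_machine U) x y : 0 < Kc U x y.
Proof.
  destruct (Kc_spec U HU x y) as [(p & Hp & Hl) _]. rewrite <- Hl.
  destruct p as [|b p]; [|simpl; lia].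
  destruct (short_programs U HU (fun _ a _ => a) (PProj 1)) as [c Hc];
    [intros; ev_as|].
  destruct (Hc [] y) as (q & Hq & _ & Hqy).
  elim (proj2 (proj1 HU) y [] q); try congruence.
  exists q. auto.
Qed.

(** The source of all upper bounds: [H] also sees the length of [w], so a number [m] together with
    [m] further bits costs [2 * m + O(1)]. *)
Lemma Kc_le U (HU : universal_pf_machine U) H h :
  (forall m a b, eval h [m; a; b] (H m a b)) ->
  exists c, forall w b,
    Kc U (dec_bits (H (length w) (enc_bits w) b)) (dec_bits b) <= 2 * length w + c.
Proof.
  intros Hh. destruct (short_programs U HU H h Hh) as [c Hc]. exists c. intros w b.
  destruct (Hc w (dec_bits b)) as (p & _ & Hl & Hp). rewrite enc_dec_bits in Hp.
  apply (proj2 (Kc_spec U HU _ _)) in Hp. lia.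
Qed.

Lemma functional_choice (X Y : Type) (R : X -> Y -> Prop) :
  (forall x, exists y, R x y) -> exists g, forall x, R x (g x).
Proof.
  intros H. exists (fun x => proj1_sig (constructive_indefinite_description _ (H x))).
  intros x. apply proj2_sig.
Qed.

(** Pigeonhole: distinct outputs have distinct shortest programs, and only [2 ^ b - 1] strings are
    shorter than [b]. *)
Lemma Kc_counting U (HU : universal_pf_machine U) y b (g : nat -> bits) :
  (forall i j, g i = g j -> i = j) -> exists i, i < 2 ^ b /\ b <= Kc U (g i) y.
Proof.
  intros Hg. apply NNPP. intros Hno.
  assert (Hlt : forall i, i < 2 ^ b -> Kc U (g i) y < b).
  { intros i Hi. apply Nat.nle_gt. intros H. apply Hno. eauto. }
  destruct (functional_choice _ _
    (fun i p => U p y = Some (g i) /\ length p = Kc U (g i) y)) as [P HP].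
  { intros i. apply (Kc_spec U HU). }
  assert (Hlen : length (map (fun i => enc_bits (P i)) (seq 0 (2 ^ b)))
                 <= length (seq 0 (2 ^ b - 1))).
  { apply NoDup_incl_length.
    - apply Injective_map_NoDup; [|apply seq_NoDup].
      intros i j Hij. apply enc_bits_inj in Hij. apply Hg.
      pose proof (proj1 (HP i)). pose proof (proj1 (HP j)). congruence.
    - intros v Hv. apply in_map_iff in Hv as (i & <- & Hi).
      apply in_seq in Hi. apply in_seq.
      pose proof (enc_bits_bounds (P i)) as [_ Hb].
      rewrite (proj2 (HP i)) in Hb.
      assert (2 ^ S (Kc U (g i) y) <= 2 ^ b)
        by (apply Nat.pow_le_mono_r; [lia|apply Hlt; lia]).
      lia. }
  rewrite length_map, !length_seq in Hlen.
  pose proof (Nat.pow_nonzero 2 b). lia.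
Qed.

(** * The distance and its approximations *)

(** [E] is at least [Kc U y x] and the denominator is positive by [Kc_pos]; the rest is cross
    multiplication. *)
Lemma NID_gt U (HU : universal_pf_machine U) x y k :
  Nat.max (K U x) (K U y) < Pos.to_nat k * Kc U y x -> ((1 # k) < NID U (x, y))%Q.
Proof.
  intros H. unfold NID; cbn [fst snd].
  pose proof (Kc_pos U HU x []) as Hpos. fold (K U x) in Hpos.
  assert (HE : Kc U y x <= E U x y) by (unfold E; lia).
  assert (HE' : Pos.to_nat k * Kc U y x <= Pos.to_nat k * E U x y)
    by (now apply Nat.mul_le_mono_l).
  generalize dependent (E U x y); intros e HE HE'.
  assert (H1 : Nat.max (K U x) (K U y) < Pos.to_nat k * e) by lia.
  assert (H2 : 0 < Nat.max (K U x) (K U y)) by lia.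
  generalize dependent (Nat.max (K U x) (K U y)); intros d _ H1 H2.
  apply Qlt_shift_div_l; unfold Qlt, natQ, inject_Z; cbn -[Z.mul]; [lia|].
  nia.
Qed.

Lemma NID_lt U x y k :
  Pos.to_nat k * E U x y < K U x -> (NID U (x, y) < (1 # k))%Q.
Proof.
  intros H. unfold NID; cbn [fst snd].
  assert (H1 : Pos.to_nat k * E U x y < Nat.max (K U x) (K U y)) by lia.
  generalize dependent (Nat.max (K U x) (K U y)); intros d H1.
  generalize dependent (E U x y); intros e _ H1.
  apply Qlt_shift_div_r; unfold Qlt, natQ, inject_Z; cbn -[Z.mul]; [lia|].
  nia.
Qed.

Lemma approximates_gt f F z q :
  approximates f F -> (q < F z)%Q ->
  exists s0, forall s, s0 <= s -> (q <= f z s)%Q.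
Proof.
  intros Hf Hq. destruct (Hf z (F z - q)%Q) as [s0 Hs0].
  - now apply Qlt_minus_iff in Hq.
  - exists s0. intros s Hs. specialize (Hs0 s Hs).
    apply Qabs_Qlt_condition in Hs0 as [H _]. lra.
Qed.

Lemma approximates_lt f F z q :
  approximates f F -> (F z < q)%Q ->
  exists s0, forall s, s0 <= s -> (f z s <= q)%Q.
Proof.
  intros Hf Hq. destruct (Hf z (q - F z)%Q) as [s0 Hs0].
  - now apply Qlt_minus_iff in Hq.
  - exists s0. intros s Hs. specialize (Hs0 s Hs).
    apply Qabs_Qlt_condition in Hs0 as [_ H]. lra.
Qed.

(** A strict drop cannot happen before the turning point, so [s2] already lies in the nonincreasing
    phase. *)
Lemma phases_drop g s1 s2 :
  phases true 2 g -> s1 <= s2 -> (g s2 < g s1)%Q ->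
  forall t, s2 <= t -> (g t <= g s2)%Q.
Proof.
  intros (s & Hup & Hdown) Hs Hlt t Ht. cbn in Hdown.
  destruct (Nat.lt_ge_cases s2 s) as [H|H].
  - exfalso. apply (Qlt_not_le _ _ Hlt). apply Hup. lia.
  - specialize (Hdown (s2 - s) (t - s) ltac:(lia)).
    now replace (s + (s2 - s)) with s2 in Hdown by lia;
      replace (s + (t - s)) with t in Hdown by lia.
Qed.

Lemma drop_bounds_limit f F z s1 s2 q r :
  approximates f F -> phases true 2 (f z) -> s1 <= s2 ->
  (q < r)%Q -> (r <= f z s1)%Q -> (f z s2 <= q)%Q -> (F z <= q)%Q.
Proof.
  intros Hf Hph Hs Hqr H1 H2. apply Qnot_lt_le. intros Hlt.
  (* The midpoint of [q] and [F z] gives eventual values strictly above [q], which contradicts the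
     bound after the drop. *)
  assert (Hmid : ((q + F z) / 2 < F z)%Q) by (apply Qlt_shift_div_r; lra).
  assert (Hmid' : (q < (q + F z) / 2)%Q) by (apply Qlt_shift_div_l; lra).
  destruct (approximates_gt f F z _ Hf Hmid) as [s0 Hs0].
  specialize (Hs0 (Nat.max s0 s2) ltac:(lia)).
  pose proof (phases_drop (f z) s1 s2 Hph Hs ltac:(lra) (Nat.max s0 s2) ltac:(lia)).
  lra.
Qed.

Lemma eventually_all_below (P : nat -> nat -> Prop) n :
  (forall i, i < n -> exists s0, forall s, s0 <= s -> P i s) ->
  exists s0, forall i s, i < n -> s0 <= s -> P i s.
Proof.
  induction n as [|n IH]; intros H; [exists 0; intros; lia|].
  destruct IH as [s1 H1]; [intros i Hi; apply H; lia|].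
  destruct (H n) as [s2 H2]; [lia|].
  exists (Nat.max s1 s2). intros i s Hi Hs.
  destruct (Nat.eq_dec i n) as [->|]; [apply H2|apply H1]; lia.
Qed.

(* [enc_Z] sends exactly the positive integers to odd codes. *)
Definition test_ge16 (c : nat) : nat :=
  (1 - parity (cfst c)) + (S (csnd c) - 8 * S (cfst c)).

(** A numerator [p > 0] has code [2 * p - 1], so [8 * S (cfst c)] is [16 * p], to be compared with
    the denominator [S (csnd c)]. *)
Lemma test_ge16_zero q : test_ge16 (enc_Q q) = 0 <-> ((1 # 16) <= q)%Q.
Proof.
  unfold test_ge16, enc_Q. rewrite cfst_cpair, csnd_cpair.
  destruct q as [[|p|p] d]; unfold Qle; cbn [Qnum Qden enc_Z].
  - simpl parity. split; lia.
  - replace (2 * Pos.to_nat p - 1) with (S (2 * (Pos.to_nat p - 1))) by lia.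
    rewrite (proj2 (parity_double _)). split; lia.
  - rewrite (proj1 (parity_double _)). split; lia.
Qed.

Definition ptest_ge16 :=
  PComp padd [PComp psub [pconst 1; PComp pparity [pcfst]];
              PComp psub [PComp PSucc [pcsnd]; PComp pmul [pconst 8; PComp PSucc [pcfst]]]].
Lemma eval_ptest_ge16 c : eval ptest_ge16 [c] (test_ge16 c).
Proof. unfold ptest_ge16. ev_as. Qed.
#[local] Hint Resolve eval_ptest_ge16 : ev.

(** The parity factor accepts every value that is not positive; for a numerator [p > 0] the product
    [16 * S (cfst c)] is [32 * p]. *)
Definition test_le32 (c : nat) : nat :=
  parity (cfst c) * (16 * S (cfst c) - S (csnd c)).

Lemma test_le32_zero q : test_le32 (enc_Q q) = 0 <-> (q <= (1 # 32))%Q.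
Proof.
  unfold test_le32, enc_Q. rewrite cfst_cpair, csnd_cpair.
  destruct q as [[|p|p] d]; unfold Qle; cbn [Qnum Qden enc_Z].
  - simpl parity. split; lia.
  - replace (2 * Pos.to_nat p - 1) with (S (2 * (Pos.to_nat p - 1))) by lia.
    rewrite (proj2 (parity_double _)). split; lia.
  - rewrite (proj1 (parity_double _)). split; lia.
Qed.

Definition ptest_le32 :=
  PComp pmul [PComp pparity [pcfst];
              PComp psub [PComp pmul [pconst 16; PComp PSucc [pcfst]]; PComp PSucc [pcsnd]]].
Lemma eval_ptest_le32 c : eval ptest_le32 [c] (test_le32 c).
Proof. unfold ptest_le32. ev_as. Qed.
#[local] Hint Resolve eval_ptest_le32 : ev.

(** * The diagonal construction *)

Definition triple (x j i : nat) : nat := cpair x (cpair j i).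

Lemma triple_inj x j i x' j' i' :
  triple x j i = triple x' j' i' -> x = x' /\ j = j' /\ i = i'.
Proof. intros H. apply cpair_inj in H as [-> H]. now apply cpair_inj in H as [-> ->]. Qed.

Definition ptriple := PComp pcpair [PProj 0; PComp pcpair [PProj 1; PProj 2]].
Lemma eval_ptriple x j i : eval ptriple [x; j; i] (triple x j i).
Proof. unfold ptriple. ev_as. Qed.
#[local] Hint Resolve eval_ptriple : ev.

(** A word of length [m] thus carries both [m] and an index below [2 ^ m]; the machines below
    recover the index from the code [a] as [S a - 2 ^ m]. *)
Lemma word_of_index m i : i < 2 ^ m -> exists w, length w = m /\ S (enc_bits w) - 2 ^ m = i.
Proof.
  intros Hi. pose proof (Nat.pow_nonzero 2 m).
  exists (dec_bits (i + 2 ^ m - 1)). split.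
  - apply length_of_enc_bounds; rewrite enc_dec_bits; simpl; lia.
  - rewrite enc_dec_bits. lia.
Qed.

(** Otherwise each [j < 2 ^ n] has some [i] whose triple has complexity below [n] given [x]. These
    triples differ in [j], against the counting bound. *)
Lemma exists_far_block U (HU : universal_pf_machine U) n N x :
  exists j, j < 2 ^ n /\
    forall i, i < N -> n <= Kc U (dec_bits (triple x j i)) (dec_bits x).
Proof.
  apply NNPP. intros Hno.
  destruct (functional_choice nat nat (fun j i => j < 2 ^ n ->
    Kc U (dec_bits (triple x j i)) (dec_bits x) < n)) as [g Hg].
  { intros j. apply NNPP. intros Hj. apply Hno. exists j. split.
    (* For [j] out of range the guarded relation holds vacuously, with 0 as a dummy index. *)
    - apply NNPP. intros H. apply Hj. exists 0. tauto.
    - intros i _. apply Nat.nlt_ge. intros H. apply Hj. eauto. }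
  destruct (Kc_counting U HU (dec_bits x) n (fun j => dec_bits (triple x j (g j))))
    as (j & Hj & HK).
  - intros j j' H. now apply dec_bits_inj, triple_inj in H.
  - specialize (Hg j Hj). lia.
Qed.

Lemma exists_high_stage U (HU : universal_pf_machine U) f :
  approximates f (NID U) -> forall m x, exists j s, forall i, i < 2 ^ m ->
    ((1 # 16) <= f (dec_bits x, dec_bits (triple x j i)) s)%Q.
Proof.
  intros Hf m x.
  destruct (Kc_le U HU (fun _ a _ => a) (PProj 1)) as [c Hc]; [intros; ev_as|].
  assert (HK : forall v k, v < 2 ^ k -> K U (dec_bits v) <= 2 * k + c).
  { intros v k Hv. apply length_dec_bits_le in Hv.
    specialize (Hc (dec_bits v) 0). rewrite enc_dec_bits in Hc.
    unfold K. simpl (dec_bits 0) in Hc. lia. }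
  (* The terms [m] and [x] put [i] and [x] below [2 ^ n]. Then [K] of the triple is at most
     [2 * (4 * n + 6) + c], which is less than [16 * n] thanks to [c + 13]. *)
  set (n := m + x + c + 13).
  destruct (exists_far_block U HU n (2 ^ m) x) as (j & Hj & Hfar).
  assert (Hmn : 2 ^ m <= 2 ^ n) by (apply Nat.pow_le_mono_r; lia).
  assert (Hx : x < 2 ^ n).
  { apply Nat.lt_le_trans with (2 ^ x); [apply Nat.pow_gt_lin_r; lia|].
    apply Nat.pow_le_mono_r; lia. }
  destruct (eventually_all_below (fun i s =>
    ((1 # 16) <= f (dec_bits x, dec_bits (triple x j i)) s)%Q) (2 ^ m)) as [s Hs].
  - intros i Hi. apply (approximates_gt f (NID U)); [exact Hf|].
    apply (NID_gt U HU). specialize (Hfar i Hi).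
    assert (Hy : triple x j i < 2 ^ (2 * (2 * n + 2) + 2)).
    { apply cpair_lt.
      - apply Nat.lt_le_trans with (2 ^ n); [exact Hx|]. apply Nat.pow_le_mono_r; lia.
      - apply cpair_lt; lia. }
    apply HK in Hx, Hy. lia.
  - exists j, s. intros i Hi. now apply Hs.
Qed.

Lemma exists_low_stage U (HU : universal_pf_machine U) f J pJ :
  approximates f (NID U) -> (forall m x, eval pJ [m; x] (J m x)) ->
  forall m, exists x s, forall i, i < 2 ^ m ->
    (f (dec_bits x, dec_bits (triple x (cfst (J m x)) i)) (csnd (J m x) + s)%nat
      <= (1 # 32))%Q.
Proof.
  intros Hf HJ m.
  (* Given [x] as condition [b], a word of length [m] determines the block through [J] and the index
     within it; conversely, [x] is read off the triple at constant cost. *)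
  destruct (Kc_le U HU (fun m a b => triple b (cfst (J m b)) (S a - 2 ^ m))
    (PComp ptriple [PProj 2; PComp pcfst [PComp pJ [PProj 0; PProj 2]];
       PComp psub [PComp PSucc [PProj 1]; PComp ppow2 [PProj 0]]])) as [c1 H1].
  { intros. eapply eval_comp3; [ev| |ev|ev].
    eapply eval_comp1; [|ev]. eapply eval_comp2; [ev..|apply HJ]. }
  destruct (Kc_le U HU (fun _ _ b => cfst b) (PComp pcfst [PProj 2])) as [c2 H2];
    [intros; ev_as|].
  (* Chosen to exceed 32 times the bound on [E]; counting then provides an [x] with [K] at least
     [n]. *)
  set (n := S (32 * (2 * m + c1 + c2))).
  destruct (Kc_counting U HU [] n dec_bits dec_bits_inj) as (x & _ & Hx).
  fold (K U (dec_bits x)) in Hx.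
  exists x.
  destruct (eventually_all_below (fun i s =>
    (f (dec_bits x, dec_bits (triple x (cfst (J m x)) i)) s <= (1 # 32))%Q) (2 ^ m))
    as [s Hs].
  - intros i Hi. apply (approximates_lt f (NID U)); [exact Hf|].
    apply NID_lt. destruct (word_of_index m i Hi) as (w & Hw & Hwi).
    specialize (H1 w x). rewrite Hw, Hwi in H1.
    specialize (H2 [] (triple x (cfst (J m x)) i)).
    unfold triple in H2 at 1. rewrite cfst_cpair in H2.
    unfold E. simpl length in H2. lia.
  - exists s. intros i Hi. apply Hs; lia.
Qed.

Theorem mainTheorem7 (U : machine) (HU : universal_pf_machine U) :
  ~ Sigma_n 2 (NID U).
Proof.
  intros (f & [e He] & Hf & Hph).
  set (F := fun x y s => enc_Q (f (dec_bits x, dec_bits y) s)).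
  set (pF := PComp e [PComp pcpair [PProj 0; PProj 1]; PProj 2]).
  assert (HF : forall x y s, eval pF [x; y; s] (F x y s)).
  { intros x y s. eapply eval_comp2; [ev..|].
    specialize (He (dec_bits x, dec_bits y) s).
    unfold enc_pair in He; cbn [fst snd] in He. rewrite !enc_dec_bits in He. exact He. }
  (* [pt] takes the arguments [i; q; m; x]. *)
  set (pt := PComp ptest_ge16 [PComp pF [PProj 3;
    PComp ptriple [PProj 3; PComp pcfst [PProj 1]; PProj 0]; PComp pcsnd [PProj 1]]]).
  (* One number [q] codes both the block [j] and the stage, so a single minimization searches for
     both. *)
  set (pJ := PMin (PComp (psum pt) [PComp ppow2 [PProj 1]; PProj 0; PProj 1; PProj 2])).
  destruct (functional_choice (nat * nat) nat (fun mx q =>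
    (forall i, i < 2 ^ fst mx -> ((1 # 16) <= f (dec_bits (snd mx),
       dec_bits (triple (snd mx) (cfst q) i)) (csnd q))%Q) /\
    eval pJ [fst mx; snd mx] q)) as [J0 HJ0].
  { intros [m x]; cbn [fst snd].
    destruct (eval_pmin
      (PComp (psum pt) [PComp ppow2 [PProj 1]; PProj 0; PProj 1; PProj 2])
      (fun q => sum_below
        (fun i => test_ge16 (F x (triple x (cfst q) i) (csnd q))) (2 ^ m)) [m; x])
      as (q & Hq & Hev).
    - intros q. eapply eval_comp4; [ev..|]. apply eval_psum. intros i.
      eapply eval_comp1; [|ev]. eapply eval_comp3; [ev..|apply HF].
    - destruct (exists_high_stage U HU f Hf m x) as (j & s & Hjs).
      exists (cpair j s). apply sum_below_zero. intros i Hi.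
      rewrite cfst_cpair, csnd_cpair. apply test_ge16_zero. auto.
    - exists q. split; [|exact Hev]. intros i Hi. apply test_ge16_zero.
      now apply (proj1 (sum_below_zero _ _) Hq). }
  set (J := fun m x => J0 (m, x)).
  assert (HJ : forall m x, eval pJ [m; x] (J m x)) by (intros m x; apply (HJ0 (m, x))).
  assert (Hhigh : forall m x i, i < 2 ^ m -> ((1 # 16) <= f (dec_bits x,
    dec_bits (triple x (cfst (J m x)) i)) (csnd (J m x)))%Q)
    by (intros m x; apply (HJ0 (m, x))).
  (* From here on only two facts about [J] matter: [pJ] computes it, and its stage makes the whole
     block high. *)
  clearbody J pJ. clear J0 HJ0.
  (* [pJx] and [pt'] take the arguments [i; q; m] and a dummy fourth one. *)
  set (pJx := PComp pJ [PProj 2; PComp pcfst [PProj 1]]).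
  set (pt' := PComp ptest_le32 [PComp pF [PComp pcfst [PProj 1];
    PComp ptriple [PComp pcfst [PProj 1]; PComp pcfst [pJx]; PProj 0];
    PComp padd [PComp pcsnd [pJx]; PComp pcsnd [PProj 1]]]]).
  (* Here [q] codes [x] and a delay added to the stage from [J], so the low stage never precedes the
     high one. *)
  set (pB := PMin (PComp (psum pt') [PComp ppow2 [PProj 1]; PProj 0; PProj 1; PProj 1])).
  destruct (functional_choice nat nat (fun m q =>
    (forall i, i < 2 ^ m -> (f (dec_bits (cfst q),
       dec_bits (triple (cfst q) (cfst (J m (cfst q))) i))
       (csnd (J m (cfst q)) + csnd q)%nat <= (1 # 32))%Q) /\
    eval pB [m] q)) as [B HB].
  { intros m.
    destruct (eval_pmin
      (PComp (psum pt') [PComp ppow2 [PProj 1]; PProj 0; PProj 1; PProj 1])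
      (fun q => sum_below
        (fun i => test_le32 (F (cfst q) (triple (cfst q) (cfst (J m (cfst q))) i)
           (csnd (J m (cfst q)) + csnd q))) (2 ^ m)) [m])
      as (q & Hq & Hev).
    - intros q. eapply eval_comp4; [ev..|]. apply eval_psum. intros i.
      assert (HJx : eval pJx [i; q; m; m] (J m (cfst q)))
        by (eapply eval_comp2; [ev..|apply HJ]).
      eapply eval_comp1; [|ev].
      eapply eval_comp3; [ev| | |apply HF].
      + eapply eval_comp3; [ev|eapply eval_comp1; [exact HJx|ev]|ev|ev].
      + eapply eval_comp2; [eapply eval_comp1; [exact HJx|ev]|ev|ev].
    - destruct (exists_low_stage U HU f J pJ Hf HJ m) as (x & s & Hxs).
      exists (cpair x s). apply sum_below_zero. intros i Hi.
      rewrite cfst_cpair, csnd_cpair. apply test_le32_zero. auto.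
    - exists q. split; [|exact Hev]. intros i Hi. apply test_le32_zero.
      now apply (proj1 (sum_below_zero _ _) Hq). }
  clearbody pB.
  set (X := fun m => cfst (B m)).
  (* [X m] is computed from [m] alone, so any word of length [m] describes it. *)
  destruct (Kc_le U HU (fun m a b => X m) (PComp pcfst [PComp pB [PProj 0]]))
    as [c1 H1].
  { intros. eapply eval_comp1; [eapply eval_comp1; [ev|apply HB]|ev]. }
  destruct (Kc_le U HU (fun m a b => triple (X m) (cfst (J m (X m))) (S a - 2 ^ m))
    (PComp ptriple [PComp pcfst [PComp pB [PProj 0]];
       PComp pcfst [PComp pJ [PProj 0; PComp pcfst [PComp pB [PProj 0]]]];
       PComp psub [PComp PSucc [PProj 1]; PComp ppow2 [PProj 0]]])) as [c2 H2].
  { intros m a b.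
    assert (HX : eval (PComp pcfst [PComp pB [PProj 0]]) [m; a; b] (X m))
      by (eapply eval_comp1; [eapply eval_comp1; [ev|apply HB]|ev]).
    eapply eval_comp3; [exact HX| |ev|ev].
    eapply eval_comp1; [|ev]. eapply eval_comp2; [ev|exact HX|apply HJ]. }
  (* Makes [2 * m + c1] and [2 * m + c2] smaller than [3 * m], well below 32 times the lower bound
     [m] on the conditional complexity. *)
  set (m := S (c1 + c2)).
  destruct (Kc_counting U HU (dec_bits (X m)) m
    (fun i => dec_bits (triple (X m) (cfst (J m (X m))) i))) as (i & Hi & HK).
  { intros i i' H. now apply dec_bits_inj, triple_inj in H. }
  destruct (word_of_index m i Hi) as (w & Hw & Hwi).
  (* The condition 0 codes the empty string, so these bounds concern the unconditional [K]. *)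
  specialize (H1 w 0). specialize (H2 w 0). rewrite Hw in H1, H2. rewrite Hwi in H2.
  simpl (dec_bits 0) in H1, H2.
  fold (K U (dec_bits (X m))) in H1.
  fold (K U (dec_bits (triple (X m) (cfst (J m (X m))) i))) in H2.
  apply (Qlt_not_le (1 # 32)
    (NID U (dec_bits (X m), dec_bits (triple (X m) (cfst (J m (X m))) i)))).
  - apply (NID_gt U HU). lia.
  (* On this pair [f] falls from at least 1/16 to at most 1/32, which uses up its only change of
     direction. *)
  - apply (drop_bounds_limit f (NID U) _ (csnd (J m (X m)))
      (csnd (J m (X m)) + csnd (B m)) _ (1 # 16)); auto.
    + lia.
    + reflexivity.
    + now apply HB.
Qed.
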